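(* Let $(Q_k)_{k\ge0}$ be generated by deflated Q-value iteration \[ Q_{k+1}=F(Q_k)+\frac{\gamma}{1-\gamma}\Big(\frac1n\mathbf 1^\top(F(Q_k)-Q_k)\Big)\mathbf 1,\qquad k\ge0, \] from some $Q_0\in\mathbb R^n$, and for each $k$ let $\mu_k$ be a stochastic stationary policy with $F(Q_k)-Q^\star=A_{\mu_k}(Q_k-Q^\star)$ (such a policy always exists). Define \[ e_k:=Q_k-Q^\star,\qquad z_k:=\boldsymbol{\Pi}_\perp e_k,\qquad a_k:=\frac1n\mathbf 1^\top e_k . \] Then, for all $k\ge0$, \[ z_{k+1}=\bar A_{\mu_k}z_k,\qquad a_{k+1}=\ell_{\mu_k}z_k,\qquad\text{where } \ell_\mu:=\frac{1}{n(1-\gamma)}\mathbf 1^\top A_\mu . \] Equivalently, \[ \begin{bmatrix} a_{k+1} \\ z_{k+1} \end{bmatrix}=D_{\mu_k}\begin{bmatrix} a_k \\ z_k \end{bmatrix},\qquad D_\mu:=\begin{bmatrix} 0 & \ell_\mu \\ 0 & \bar A_\mu \end{bmatrix},\qquad k\ge0 . \]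
   Context: Setting: a finite discounted Markov decision process with finite nonempty state space $\mathcal S$, finite nonempty action space $\mathcal A$, transition probabilities $P(s'\mid s,a)$, real rewards $r(s,a,s')$, discount factor $\gamma\in(0,1)$, and expected reward $R(s,a):=\sum_{s'}P(s'\mid s,a)r(s,a,s')$. Put $n:=|\mathcal S||\mathcal A|$; vectors in $\mathbb R^n$ are indexed by pairs $(s,a)$. The Bellman optimality operator $F:\mathbb R^n\to\mathbb R^n$ is $(FQ)(s,a):=R(s,a)+\gamma\sum_{s'}P(s'\mid s,a)\max_{a'}Q(s',a')$, and $Q^\star$ is its unique fixed point (the optimal Q-function). $\mathbf 1$ is the all-ones vector and $\boldsymbol{\Pi}_\perp:=I-\frac1n\mathbf 1\mathbf 1^\top$. A stochastic stationary policy is a map $\mu$ assigning to each $s\in\mathcal S$ a probability distribution $\mu(\cdot\mid s)$ on $\mathcal A$. $A_\mu\in\mathbb R^{n\times n}$ has entries $A_\mu((s,a),(s',a')):=\gamma P(s'\mid s,a)\,\mu(a'\mid s')$, and $\bar A_\mu:=\boldsymbol{\Pi}_\perp A_\mu\boldsymbol{\Pi}_\perp$. *)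

(* Defs.v *)
From HB Require Import structures.
From mathcomp Require Import all_boot all_order all_algebra.
From mathcomp Require Import reals.

Set Implicit Arguments.
Unset Strict Implicit.
Unset Printing Implicit Defensive.

Import Order.TTheory GRing.Theory Num.Theory.
Local Open Scope ring_scope.

Record mdp (R : realType) (S A : finType) := MDP {
  trans : S -> A -> S -> R;
  reward : S -> A -> S -> R;
  discount : R;
  state_nonempty : (0 < #|S|)%N;
  action_nonempty : (0 < #|A|)%N;
  trans_ge0 : forall s a s', 0 <= trans s a s';
  trans_sum1 : forall s a, \sum_(s' : S) trans s a s' = 1;
  discount_gt0 : 0 < discount;
  discount_lt1 : discount < 1
}.

Record policy (R : realType) (S A : finType) := Policy {
  prob :> S -> A -> R;
  prob_ge0 : forall s a, 0 <= prob s a;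
  prob_sum1 : forall s, \sum_(a : A) prob s a = 1
}.

(* The number of state-action pairs; it equals #|S| * #|A| by card_prod.
   Index i of a vector of this size stands for the pair [enum_val i]. *)
Definition npairs (S A : finType) : nat := #|{: S * A}|.

Section Definitions.

Variables (R : realType) (S A : finType).
Local Notation n := (npairs S A).

Definition qval (Q : 'cV[R]_n) (s : S) (a : A) : R := Q (enum_rank (s, a)) 0.

(* The default value [head 0 (codom f)] is itself a value of f as soon as T is
   nonempty, so this is then the maximum of f, whatever the signs. *)
Definition maxval (T : finType) (f : T -> R) : R :=
  \big[Num.max/head 0 (codom f)]_(t : T) f t.

Definition ones : 'cV[R]_n := const_mx 1.

Definition mean (x : 'cV[R]_n) : R := n%:R^-1 * (ones^T *m x) 0 0.

Definition Pi_perp : 'M[R]_n := 1%:M - n%:R^-1 *: (ones *m ones^T).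

Variable m : mdp R S A.
Local Notation gamma := (discount m).

Definition expected_reward (s : S) (a : A) : R :=
  \sum_(s' : S) trans m s a s' * reward m s a s'.

Definition bellman (Q : 'cV[R]_n) : 'cV[R]_n :=
  \col_i let: (s, a) := enum_val i in
    expected_reward s a
    + gamma * \sum_(s' : S) trans m s a s' * maxval (qval Q s').

Definition deflated_step (Q : 'cV[R]_n) : 'cV[R]_n :=
  bellman Q + (gamma / (1 - gamma) * mean (bellman Q - Q)) *: ones.

Definition A_mx (mu : policy R S A) : 'M[R]_n :=
  \matrix_(i, j)
    let: (s, a) := enum_val i in let: (s', a') := enum_val j in
    gamma * trans m s a s' * mu s' a'.

Definition Abar_mx (mu : policy R S A) : 'M[R]_n :=
  Pi_perp *m A_mx mu *m Pi_perp.

Definition ell (mu : policy R S A) : 'rV[R]_n :=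
  (n%:R * (1 - gamma))^-1 *: (ones^T *m A_mx mu).

Definition D_mx (mu : policy R S A) : 'M[R]_(1 + n) :=
  block_mx (0 : 'M_1) (ell mu) (0 : 'cV_n) (Abar_mx mu).

End Definitions.

Arguments Pi_perp {R S A}.

(* Main.v *)
Require Import Defs.
From HB Require Import structures.
From mathcomp Require Import all_boot all_order all_algebra.
From mathcomp Require Import reals ring lra.

Set Implicit Arguments.
Unset Strict Implicit.
Unset Printing Implicit Defensive.

Import Order.TTheory GRing.Theory Num.Theory.
Local Open Scope ring_scope.

(** Two facts carry the proof.

    A difference of maxima is a mean of differences: if [a] maximises [f] and
    [b] maximises [g], then [f b - g b <= max f - max g <= f a - g a], so
    [max f - max g] is a convex combination of the values of [f - g] at [a] and
    [b].  Doing this in every state, the weights form a policy, and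
    multiplication by the transition probabilities gives the linear
    representation of [bellman m Q - bellman m Qstar].

    [A_mx m mu] is [gamma] times a stochastic matrix, so that
    [A_mx m mu *m ones = gamma *: ones] ([A_mx_ones]).  Split the error as
    [e = z + a *: ones], with [z] of mean zero.  The Bellman step sends it to
    [A_mx m mu *m z + (gamma * a) *: ones].  The mean of the Bellman residual is
    [mean (A_mx m mu *m z) - (1 - gamma) * a], and the factor
    [gamma / (1 - gamma)] is exactly the one for which the deflation term
    cancels [(gamma * a) *: ones] ([deflated_error]).  The new error hence
    depends on [z] alone, and applying [Pi_perp] and [mean] to it gives the two
    recursions. *)

(** * Differences of maxima *)

(** The codomain being nonempty, the default value of the iterated maximum is a
    value of [f] and does not exceed the largest one. *)
Lemma maxval_attained (R : realType) (T : finType) (f : T -> R) :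
  (0 < #|T|)%N ->
  exists t, maxval f = f t /\ forall u, f u <= f t.
Proof.
move=> /card_gt0P[t0 _].
have [t _ tmax] := @Order.TotalTheory.arg_maxP _ _ _ t0 predT f erefl.
have {}tmax u : f u <= f t by exact: tmax.
exists t; split=> //; apply/le_anti/andP; split; last exact: le_bigmax.
apply: bigmax_le => [|u _]; last exact: tmax.
have : head 0 (codom f) \in codom f.
  have : (0 < size (codom f))%N by rewrite size_codom; apply/card_gt0P; exists t0.
  by case: (codom f) => //= x s _; rewrite mem_head.
by case/codomP=> u ->.
Qed.

Lemma between_convex (R : realFieldType) (x y c : R) :
  x <= c <= y -> exists2 t, 0 <= t <= 1 & c = t * y + (1 - t) * x.
Proof.
move=> /andP[xc cy]; have [yx|xy] := leP y x.
  by exists 0; rewrite ?lexx ?ler01 //; lra.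
have yx0 : 0 < y - x by lra.
exists ((c - x) / (y - x)); last by field; lra.
by rewrite divr_ge0 ?ler_pdivrMr //=; lra.
Qed.

Lemma maxval_sub_convex (R : realType) (T : finType) (f g : T -> R) :
  (0 < #|T|)%N ->
  exists w : T -> R, [/\ forall t, 0 <= w t, \sum_t w t = 1
    & maxval f - maxval g = \sum_t w t * (f t - g t)].
Proof.
move=> T0.
have [a [-> fa]] := maxval_attained f T0.
have [b [-> gb]] := maxval_attained g T0.
have [|t /andP[t0 t1] fg] :=
    @between_convex _ (f b - g b) (f a - g a) (f a - g b).
  by rewrite !lerD ?lerN2 ?fa ?gb.
have pick (h : T -> R) c : \sum_u (u == c)%:R * h u = h c.
  rewrite (bigD1 c) //= eqxx mul1r big1 ?addr0 // => u /negPf ->.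
  by rewrite mul0r.
have mix (h : T -> R) :
    \sum_u (t * (u == a)%:R + (1 - t) * (u == b)%:R) * h u
    = t * h a + (1 - t) * h b.
  rewrite -[in t * h a]pick -[in (1 - t) * h b]pick !mulr_sumr -big_split /=.
  by apply: eq_bigr => u _; rewrite mulrDl !mulrA.
exists (fun u => t * (u == a)%:R + (1 - t) * (u == b)%:R); split.
- by move=> u; rewrite addr_ge0 // mulr_ge0 ?ler0n ?subr_ge0.
- under eq_bigr do rewrite -[_ + _]mulr1.
  by rewrite (mix (fun=> 1)) !mulr1 addrC subrK.
- by rewrite (mix (fun u => f u - g u)).
Qed.

(** * The transition matrix of a policy *)

Lemma A_mx_mul (R : realType) (S A : finType) (m : mdp R S A)
    (mu : policy R S A) (x : 'cV[R]_(npairs S A)) i :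
  (A_mx m mu *m x) i 0 = discount m *
    \sum_s' trans m (enum_val i).1 (enum_val i).2 s' *
      \sum_a' mu s' a' * qval x s' a'.
Proof.
rewrite mxE (reindex (@enum_rank _)) /=; last exact/onW_bij/enum_rank_bij.
rewrite mulr_sumr; under [RHS]eq_bigr do rewrite mulrA mulr_sumr.
rewrite pair_bigA; apply: eq_bigr => -[s' a'] _ /=.
by rewrite mxE enum_rankK; case: (enum_val i) => s a; rewrite !mulrA.
Qed.

Lemma A_mx_ones (R : realType) (S A : finType) (m : mdp R S A)
    (mu : policy R S A) :
  A_mx m mu *m ones R S A = discount m *: ones R S A.
Proof.
apply/colP => i; rewrite A_mx_mul !mxE; congr (_ * _).
rewrite -(trans_sum1 m (enum_val i).1 (enum_val i).2); apply: eq_bigr => s' _.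
rewrite -[RHS]mulr1 -(prob_sum1 mu s'); congr (_ * _).
by apply: eq_bigr => a' _; rewrite /qval mxE mulr1.
Qed.

(** The rewards cancel in the difference, and the convex weights relating the
    two maxima in each state are the action probabilities of the policy. *)
Lemma bellman_sub (R : realType) (S A : finType) (m : mdp R S A)
    (Q Q' : 'cV[R]_(npairs S A)) :
  exists mu : policy R S A, bellman m Q - bellman m Q' = A_mx m mu *m (Q - Q').
Proof.
have [w Pw] := fin_all_exists (fun s =>
  maxval_sub_convex (qval Q s) (qval Q' s) (action_nonempty m)).
exists (@Policy R S A w (fun s => let: And3 H _ _ := Pw s in H)
                        (fun s => let: And3 _ H _ := Pw s in H)).
apply/colP => i; rewrite A_mx_mul !mxE; case: (enum_val i) => s a /=.
rewrite opprD addrACA subrr add0r -mulrBr -sumrB; congr (_ * _).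
apply: eq_bigr => s' _; rewrite -mulrBr; congr (_ * _).
case: (Pw s') => _ _ ->; apply: eq_bigr => a' _.
by rewrite /qval !mxE.
Qed.

(** * Mean and orthogonal projection *)

Section MeanProjection.
Variables (R : realType) (S A : finType).
Local Notation n := (npairs S A).
Local Notation one := (ones R S A).
Implicit Types (x y : 'cV[R]_n) (c : R).

Lemma meanD x y : mean (x + y) = mean x + mean y.
Proof. by rewrite /mean mulmxDr mxE mulrDr. Qed.

Lemma meanZ c x : mean (c *: x) = c * mean x.
Proof. by rewrite /mean -scalemxAr mxE mulrCA. Qed.

Lemma mean_ones : (0 < n)%N -> mean one = 1.
Proof.
move=> n0; rewrite /mean mxE.
under eq_bigr do rewrite !mxE mulr1.
by rewrite sumr_const card_ord mulVf // pnatr_eq0 -lt0n.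
Qed.

Lemma Pi_perpE x : Pi_perp *m x = x - mean x *: one.
Proof.
rewrite /Pi_perp mulmxBl mul1mx -scalemxAl -mulmxA.
rewrite [one^T *m x]mx11_scalar mul_mx_scalar scalerA.
by [].
Qed.

Lemma mean_Pi_perp x : (0 < n)%N -> mean (Pi_perp *m x) = 0.
Proof.
by move=> n0; rewrite Pi_perpE -scaleNr meanD meanZ mean_ones // mulr1 subrr.
Qed.

Lemma Pi_perp_ones : (0 < n)%N -> Pi_perp *m one = 0.
Proof. by move=> n0; rewrite Pi_perpE mean_ones // scale1r subrr. Qed.

Lemma Pi_perp_idem x :
  (0 < n)%N -> Pi_perp *m (Pi_perp *m x) = Pi_perp *m x.
Proof. by move=> n0; rewrite Pi_perpE mean_Pi_perp // scale0r subr0. Qed.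

End MeanProjection.

Lemma npairs_gt0 (R : realType) (S A : finType) (m : mdp R S A) :
  (0 < npairs S A)%N.
Proof.
by rewrite /npairs card_prod muln_gt0 (state_nonempty m) (action_nonempty m).
Qed.

(** * The deflated error recursion *)

Lemma ell_mul (R : realType) (S A : finType) (m : mdp R S A)
    (mu : policy R S A) (x : 'cV[R]_(npairs S A)) :
  ell m mu *m x = ((1 - discount m)^-1 * mean (A_mx m mu *m x))%:M.
Proof.
rewrite [LHS]mx11_scalar /ell -scalemxAl -mulmxA mxE invfM /mean.
by rewrite mulrCA mulrA.
Qed.

(** The constant part of the error is an eigenvector of [A_mx m mu] and adds
    [gamma * mean e] to the Bellman step; it also adds [(gamma - 1) * mean e] to
    the mean residual, which the deflation factor turns into the opposite of
    that term. *)
Lemma deflated_error (R : realType) (S A : finType) (m : mdp R S A)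
    (mu : policy R S A) (Qstar Q : 'cV[R]_(npairs S A)) :
  bellman m Q - Qstar = A_mx m mu *m (Q - Qstar) ->
  let Az := A_mx m mu *m (Pi_perp *m (Q - Qstar)) in
  deflated_step m Q - Qstar
  = Az + (discount m / (1 - discount m) * mean Az) *: ones R S A.
Proof.
move=> FQ Az; have n0 := npairs_gt0 m.
set g := discount m in Az *; set e := Q - Qstar in FQ Az *.
have g1 : 1 - g != 0 by rewrite subr_eq0 gt_eqF // discount_lt1.
have Ae : A_mx m mu *m e = Az + (mean e * g) *: ones R S A.
  (* [e] is itself a difference, which must stay whole. *)
  rewrite /Az Pi_perpE (mulmxBr _ e) -scalemxAr A_mx_ones scalerA.
  by rewrite subrK.
have res : mean (bellman m Q - Q) = mean Az - (1 - g) * mean e.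
  have -> : bellman m Q - Q = Az + (mean e * g) *: ones R S A + (-1) *: e.
    by rewrite -Ae -FQ scaleN1r /e opprB addrA subrK.
  rewrite (meanD (_ + _)) (meanD Az) !meanZ mean_ones //; ring.
rewrite /deflated_step addrAC FQ Ae -addrA -scalerDl res.
by congr (_ + _ *: _); rewrite -/g; field.
Qed.

Theorem proposition3 (R : realType) (S A : finType) (m : mdp R S A)
    (Qstar : 'cV[R]_(npairs S A)) (Qstar_fixed : bellman m Qstar = Qstar) :
  (forall Q : 'cV[R]_(npairs S A), exists mu : policy R S A,
      bellman m Q - Qstar = A_mx m mu *m (Q - Qstar))
  /\
  (forall (Q : nat -> 'cV[R]_(npairs S A)) (mu : nat -> policy R S A),
     (forall k, Q k.+1 = deflated_step m (Q k)) ->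
     (forall k, bellman m (Q k) - Qstar = A_mx m (mu k) *m (Q k - Qstar)) ->
     let e (k : nat) : 'cV[R]_(npairs S A) := Q k - Qstar in
     let z (k : nat) : 'cV[R]_(npairs S A) := Pi_perp *m e k in
     let a (k : nat) : R := mean (e k) in
     (forall k, z k.+1 = Abar_mx m (mu k) *m z k
                /\ (a k.+1)%:M = ell m (mu k) *m z k)
     /\
     (forall k, col_mx (a k.+1)%:M (z k.+1)
                = D_mx m (mu k) *m col_mx (a k)%:M (z k))).
Proof.
split=> [Q|Q mu Qstep Qmu e z a].
  by rewrite -{1}Qstar_fixed; exact: bellman_sub.
have n0 := npairs_gt0 m.
have rec k : z k.+1 = Abar_mx m (mu k) *m z k
             /\ (a k.+1)%:M = ell m (mu k) *m z k.
  have eS : e k.+1 = A_mx m (mu k) *m z k + (discount m / (1 - discount m)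
      * mean (A_mx m (mu k) *m z k)) *: ones R S A.
    by rewrite /e Qstep (deflated_error (Qmu k)).
  split.
    rewrite /Abar_mx -!mulmxA Pi_perp_idem // /z eS mulmxDr -scalemxAr.
    by rewrite Pi_perp_ones // scaler0 addr0.
  rewrite ell_mul /a eS meanD meanZ mean_ones // mulr1; congr (_%:M).
  by field; rewrite subr_eq0 gt_eqF // discount_lt1.
split=> // k; have [-> ->] := rec k.
by rewrite /D_mx mul_block_col !mul0mx !add0r.
Qed.
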